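(* Let $(N,\mu,\nu)$ be an intuitionistic fuzzy normed space, let $(u_k)_{k\ge 1}$ be a sequence in $N$, let $a\in N$ and let $m\ge 1$ be an integer. If $(u_k)$ is statistically $(H,m)$ summable to $a$ and slowly oscillating, then $(u_k)$ is convergent to $a$ in $(N,\mu,\nu)$.
   Context: An intuitionistic fuzzy normed space (IFNS) is a triple $(N,\mu,\nu)$ where $N$ is a real vector space with zero vector $\theta$ and $\mu,\nu:N\times\mathbb{R}\to[0,1]$ satisfy, for all $u,w\in N$ and $t,s\in\mathbb{R}$: (a) $\mu(u,t)=0$ for $t\le 0$; (b) $\mu(u,t)=1$ for all $t>0$ if and only if $u=\theta$; (c) $\mu(cu,t)=\mu(u,t/|c|)$ for all $t>0$ and real $c\ne 0$; (d) $\mu(u+w,t+s)\ge\min\{\mu(u,t),\mu(w,s)\}$; (e) $\lim_{t\to\infty}\mu(u,t)=1$, and $\lim_{t\to 0}\mu(u,t)=0$ if $u\neq\theta$; (f) $\nu(u,t)=1$ for $t\le 0$; (g) $\nu(u,t)=0$ for all $t>0$ if and only if $u=\theta$; (h) $\nu(cu,t)=\nu(u,t/|c|)$ for all $t>0$ and real $c\neq 0$; (i) $\max\{\nu(u,t),\nu(w,s)\}\ge\nu(u+w,t+s)$; (j) $\lim_{t\to\infty}\nu(u,t)=0$, and $\lim_{t\to0}\nu(u,t)=1$ if $u\ne\theta$. A sequence $(u_k)$ in $N$ is convergent to $a\in N$ if for every $\varepsilon>0$ and $t>0$ there is $k_0\in\mathbb{N}$ such that $\mu(u_k-a,t)>1-\varepsilon$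 and $\nu(u_k-a,t)<\varepsilon$ for all $k\ge k_0$. A sequence $(v_k)$ in $N$ is statistically convergent to $a\in N$ with respect to $(\mu,\nu)$ if for every $\varepsilon>0$ and $t>0$, $\lim_{n\to\infty}\frac1n\left|\{k\le n:\mu(v_k-a,t)\le 1-\varepsilon\text{ or }\nu(v_k-a,t)\ge\varepsilon\}\right|=0$. The Hölder means of $(u_k)$ are defined recursively by $H^0_k=u_k$ and $H^m_k=\frac1k\sum_{j=1}^kH^{m-1}_j$ for $m\ge 1$. $(u_k)$ is statistically $(H,m)$ summable to $a$ if the sequence $(H^m_k)_{k\ge1}$ is statistically convergent to $a$. $(u_k)$ is slowly oscillating if for all $t>0$ and all $\varepsilon\in(0,1)$ there exist $\lambda>1$ and $m_0\in\mathbb{N}$ (depending on $t$ and $\varepsilon$) such that $\mu(u_k-u_n,t)>1-\varepsilon$ and $\nu(u_k-u_n,t)<\varepsilon$ whenever $m_0\le n<k\le\lfloor\lambda n\rfloor$. *)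

(* Defs.v *)
From mathcomp Require Import all_boot all_order all_algebra.
From mathcomp Require Import all_classical all_reals all_analysis.

Set Implicit Arguments.
Unset Strict Implicit.
Unset Printing Implicit Defensive.

Import Order.TTheory GRing.Theory Num.Theory.
Import numFieldNormedType.Exports.

Local Open Scope classical_set_scope.
Local Open Scope ring_scope.

(* Sequences (u_k)_{k >= 1} are functions nat -> N of which only the values at
   positive indices matter: no predicate below depends on the value at 0. *)

Record is_ifnorm (R : realType) (N : lmodType R) (mu nu : N -> R -> R) : Prop :=
  IsIFNorm {
    ifn_mu01 : forall (u : N) (t : R), 0 <= mu u t <= 1;
    ifn_nu01 : forall (u : N) (t : R), 0 <= nu u t <= 1;
    ifn_mu_le0 : forall (u : N) (t : R), t <= 0 -> mu u t = 0;
    ifn_mu_eq1 : forall u : N, (forall t : R, 0 < t -> mu u t = 1) <-> u = 0;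
    ifn_muZ : forall (c : R) (u : N) (t : R),
      0 < t -> c != 0 -> mu (c *: u) t = mu u (t / `|c|);
    ifn_muD : forall (u w : N) (t s : R),
      Num.min (mu u t) (mu w s) <= mu (u + w) (t + s);
    ifn_mu_cvgy : forall u : N, mu u t @[t --> +oo] --> (1 : R);
    ifn_mu_cvg0 : forall u : N, u != 0 ->
      mu u t @[t --> (0 : R)^'] --> (0 : R);
    ifn_nu_le0 : forall (u : N) (t : R), t <= 0 -> nu u t = 1;
    ifn_nu_eq0 : forall u : N, (forall t : R, 0 < t -> nu u t = 0) <-> u = 0;
    ifn_nuZ : forall (c : R) (u : N) (t : R),
      0 < t -> c != 0 -> nu (c *: u) t = nu u (t / `|c|);
    ifn_nuD : forall (u w : N) (t s : R),
      nu (u + w) (t + s) <= Num.max (nu u t) (nu w s);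
    ifn_nu_cvgy : forall u : N, nu u t @[t --> +oo] --> (0 : R);
    ifn_nu_cvg0 : forall u : N, u != 0 ->
      nu u t @[t --> (0 : R)^'] --> (1 : R)
  }.

Definition ifn_converges (R : realType) (N : lmodType R) (mu nu : N -> R -> R)
    (u : nat -> N) (a : N) : Prop :=
  forall eps t : R, 0 < eps -> 0 < t ->
  exists k0 : nat, forall k : nat, (1 <= k)%N -> (k0 <= k)%N ->
    mu (u k - a) t > 1 - eps /\ nu (u k - a) t < eps.

(* The cardinality is that of the set of bad indices k with 1 <= k <= n. *)
Definition ifn_stat_converges (R : realType) (N : lmodType R)
    (mu nu : N -> R -> R) (v : nat -> N) (a : N) : Prop :=
  forall eps t : R, 0 < eps -> 0 < t ->
    n%:R^-1 * #|[pred k : 'I_n.+1 | (1 <= k)%N &&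
                  ((mu (v k - a) t <= 1 - eps) || (nu (v k - a) t >= eps))]|%:R
      @[n --> \oo] --> (0 : R).

Fixpoint holder_mean (R : realType) (N : lmodType R) (u : nat -> N) (m : nat)
    : nat -> N :=
  if m is m'.+1 then
    fun k => k%:R^-1 *: \sum_(1 <= j < k.+1) holder_mean u m' j
  else u.

Definition ifn_stat_holder_summable (R : realType) (N : lmodType R)
    (mu nu : N -> R -> R) (m : nat) (u : nat -> N) (a : N) : Prop :=
  ifn_stat_converges mu nu (holder_mean u m) a.

(* The index n = 0 is excluded automatically: no k satisfies 0 < k <= 0. *)
Definition ifn_slowly_oscillating (R : realType) (N : lmodType R)
    (mu nu : N -> R -> R) (u : nat -> N) : Prop :=
  forall t eps : R, 0 < t -> 0 < eps < 1 ->
  exists (lambda : R) (m0 : nat), 1 < lambda /\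
    forall n k : nat, (m0 <= n)%N -> (n < k)%N ->
      k%:Z <= Num.floor (lambda * n%:R) ->
      mu (u k - u n) t > 1 - eps /\ nu (u k - u n) t < eps.

(* Main.v *)
(* For a fixed eps the conditions mu x t > 1 - eps and nu x t < eps cut out the
   balls of a seminorm p, because the triangle inequalities use min and max; all
   the hypotheses then become statements about p. For p one argues classically:
   Cesaro means of a slowly oscillating sequence u are slowly oscillating, since
   u_n - s_n is bounded and n (s_k - s_n) is the sum over n < j <= k of
   u_j - s_k. A slowly oscillating statistically convergent sequence converges,
   since every window ]n, (1 + 1/q) n] contains a good index. Finally, the same
   identity shows that convergence of the means s forces convergence of u,
   which is applied m times to descend from H^m to u. *)

Require Import Defs.
From mathcomp Require Import all_boot all_order all_algebra.
From mathcomp Require Import all_classical all_reals all_analysis.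
From mathcomp Require Import zify ring lra.

Set Implicit Arguments.
Unset Strict Implicit.
Unset Printing Implicit Defensive.

Import Order.TTheory GRing.Theory Num.Theory.
Import numFieldNormedType.Exports.

Local Open Scope classical_set_scope.
Local Open Scope ring_scope.

(** * Slow oscillation and Cesàro means for a single seminorm *)

Record is_seminorm (R : realType) (N : lmodType R) (p : N -> R) : Prop :=
  IsSeminorm {
    seminormD : forall x y, p (x + y) <= p x + p y;
    seminormZ : forall c x, p (c *: x) = `|c| * p x
  }.

(** One step of the Hölder recursion: [holder_mean u m.+1] is convertible to
    [cesaro (holder_mean u m)]. *)
Definition cesaro (R : realType) (N : lmodType R) (u : nat -> N) (k : nat)
    : N :=
  k%:R^-1 *: \sum_(1 <= j < k.+1) u j.

(* The window [q * d <= n] is [n + d <= (1 + q^-1) * n], so [1 + q^-1] plays the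
   role of lambda. *)
Definition slowly_oscillating (R : realType) (N : lmodType R) (p : N -> R)
    (u : nat -> N) : Prop :=
  forall t : R, 0 < t -> exists q m0 : nat, (0 < q)%N /\
    forall n d : nat, (m0 <= n)%N -> (q * d <= n)%N ->
      p (u (n + d)%N - u n) <= t.

Definition seminorm_cvg (R : realType) (N : lmodType R) (p : N -> R)
    (u : nat -> N) (a : N) : Prop :=
  forall t : R, 0 < t -> exists n0 : nat,
    forall n : nat, (n0 <= n)%N -> p (u n - a) <= t.

Section Tauberian.
Context (R : realType) (N : lmodType R) (p : N -> R).
Hypothesis pP : is_seminorm p.
Implicit Types (u : nat -> N) (x y z : N).

Lemma seminorm0 : p 0 = 0.
Proof. by rewrite -(scale0r 0) (seminormZ pP) normr0 mul0r. Qed.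

Lemma seminormN x : p (- x) = p x.
Proof. by rewrite -scaleN1r (seminormZ pP) normrN1 mul1r. Qed.

Lemma seminorm_distC x y : p (x - y) = p (y - x).
Proof. by rewrite -seminormN opprB. Qed.

Lemma seminorm_dist_triangle z x y : p (x - y) <= p (x - z) + p (z - y).
Proof. by rewrite (le_trans _ (seminormD pP _ _)) // addrA subrK. Qed.

Lemma seminorm_ge0 x : 0 <= p x.
Proof.
have := seminormD pP x (- x); rewrite subrr seminorm0 seminormN; lra.
Qed.

Lemma seminorm_sum (I : Type) (r : seq I) (F : I -> N) :
  p (\sum_(i <- r) F i) <= \sum_(i <- r) p (F i).
Proof.
elim: r => [|i r IH]; first by rewrite !big_nil seminorm0.
by rewrite !big_cons (le_trans (seminormD pP _ _)) // lerD2l.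
Qed.

Lemma seminorm_sum_le (n m : nat) (F : nat -> N) (c : R) :
  (forall j, (n <= j < m)%N -> p (F j) <= c) ->
  p (\sum_(n <= j < m) F j) <= (m - n)%:R * c.
Proof.
move=> Fc; rewrite (le_trans (seminorm_sum _ _)) //.
by rewrite mulr_natl -sumr_const_nat; apply: ler_sum_nat.
Qed.

Lemma cesaroE u n : (0 < n)%N -> n%:R *: cesaro u n = \sum_(1 <= j < n.+1) u j.
Proof.
by move=> n0; rewrite /cesaro scalerA mulfV ?scale1r // pnatr_eq0 -lt0n.
Qed.

(** Write the factor [n] of [cesaro u (n + d)] as [(n + d) - d]: the terms up to [n] then cancel
    between the two partial sums. *)
Lemma cesaro_shift u n d : (0 < n)%N ->
  n%:R *: (cesaro u (n + d) - cesaro u n) =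
  \sum_(n.+1 <= j < (n + d).+1) (u j - cesaro u (n + d)).
Proof.
move=> n0; rewrite sumrB sumr_const_nat subSS addKn scalerBr cesaroE //.
have nd0 : (0 < n + d)%N by rewrite ltn_addr.
have := cesaroE u nd0.
rewrite (@big_cat_nat _ _ _ n.+1) //= ?ltnS ?leq_addr // => E.
rewrite [X in X - _ = _](_ : _ = (n + d)%:R *: cesaro u (n + d)
   - cesaro u (n + d) *+ d); last first.
  by rewrite natrD scalerDl (scaler_nat d) addrK.
by rewrite E [_ + \sum_(n.+1 <= _ < _) _]addrC addrAC addrK.
Qed.

(* Passing from [n] to [n - n %/ q.+1], which stays within the oscillation
   window, costs at most [n] and decreases the bound by at least [n]. *)
Lemma oscillation_sum_le u : slowly_oscillating p u ->
  exists2 C : R, 0 <= C &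
    forall n, \sum_(1 <= j < n.+1) p (u n - u j) <= C * n%:R.
Proof.
move=> /(_ 1 ltr01)[q [m0 [q0 osc]]].
pose A n := \sum_(1 <= j < n.+1) p (u n - u j).
have A0 n : 0 <= A n by apply: sumr_ge0 => j _; exact: seminorm_ge0.
(* For [n >= M] the shift [d = n %/ q.+1] is positive and [n - d >= m0]. In [C], the first summand
   pays for the induction step, as [n <= 2 * q.+1 * d]; the sum of the [A k] covers the cases
   [n < M]. *)
pose M := (q + 2 * m0).+1.
pose C := (2 * q.+1)%:R + \sum_(0 <= k < M) A k.
have S0 : 0 <= \sum_(0 <= k < M) A k by apply: sumr_ge0.
exists C => [|n]; first by rewrite addr_ge0.
elim/ltn_ind: n => n IH.
have [nM|Mn] := ltnP n M.
  case: n nM {IH} => [|n] nM; first by rewrite big_geq // mulr0.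
  rewrite (@le_trans _ _ C) //; last by rewrite ler_peMr ?addr_ge0 // ler1n.
  rewrite -/(A n.+1) /C (bigD1_seq n.+1) ?iota_uniq ?mem_index_iota //=.
  have : 0 <= \sum_(i <- index_iota 0 M | i != n.+1) A i by apply: sumr_ge0.
  have : 0 <= (2 * q.+1)%:R :> R by [].
  lra.
set d := (n %/ q.+1)%N.
have dn : (q.+1 * d <= n)%N by rewrite mulnC leq_trunc_div.
have d2n : (n <= 2 * q.+1 * d)%N.
  have := divn_eq n q.+1; have := ltn_pmod n (ltn0Sn q); rewrite -/d /M in Mn *.
  have : (0 < d)%N by rewrite divn_gt0 //; lia.
  nia.
have d0 : (0 < d)%N by rewrite divn_gt0 // -/M; rewrite /M in Mn; lia.
have [n' nE] : exists n', n = (n' + d)%N by exists (n - d)%N; nia.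
have qd : (q * d <= n')%N by nia.
have m0n' : (m0 <= n')%N by rewrite /M in Mn; nia.
rewrite (@big_cat_nat _ _ _ n'.+1) //=; last by lia.
have un : p (u n - u n') <= 1 by rewrite nE; apply: osc.
have h1 : \sum_(1 <= j < n'.+1) p (u n - u j) <= A n' + n'%:R.
  rewrite (_ : n'%:R = \sum_(1 <= j < n'.+1) 1); last first.
    by rewrite sumr_const_nat subSS subn0.
  rewrite -big_split /=; apply: ler_sum_nat => j _.
  have := seminorm_dist_triangle (u n') (u n) (u j); lra.
have h2 : \sum_(n'.+1 <= j < n.+1) p (u n - u j) <= d%:R.
  rewrite (_ : d%:R = \sum_(n'.+1 <= j < n.+1) 1); last first.
    by rewrite sumr_const_nat subSS nE addKn.
  apply: ler_sum_nat => j /andP[j1 j2].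
  have -> : n = (j + (n - j))%N by lia.
  by apply: osc; nia.
have h3 : A n' <= C * n'%:R by apply: IH; lia.
have h4 : n%:R <= C * d%:R.
  rewrite (@le_trans _ _ ((2 * q.+1)%:R * d%:R)) // -?natrM ?ler_nat //.
  by rewrite natrM ler_wpM2r // lerDl.
have nR : n%:R = n'%:R + d%:R :> R by rewrite nE natrD.
move: h4; rewrite nR mulrDr; lra.
Qed.

(** Multiplied by [n], the difference becomes the sum of [u n - u j] over [1 <= j <= n], which
    [oscillation_sum_le] bounds by [C * n]. *)
Lemma cesaro_dist_bounded u : slowly_oscillating p u ->
  exists2 C : R, 0 <= C & forall n, (0 < n)%N -> p (u n - cesaro u n) <= C.
Proof.
move=> /oscillation_sum_le[C C0 HC]; exists C => // n n0.
have n0R : 0 < n%:R :> R by rewrite ltr0n.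
rewrite -(ler_pM2l n0R) -{1}(ger0_norm (ltW n0R)) -(seminormZ pP) scalerBr.
rewrite cesaroE // [n%:R * C]mulrC (le_trans _ (HC n)) //.
rewrite (le_trans _ (seminorm_sum _ _)) //.
by rewrite sumrB sumr_const_nat subSS subn0 scaler_nat.
Qed.

Lemma slowly_oscillating_cesaro u :
  slowly_oscillating p u -> slowly_oscillating p (cesaro u).
Proof.
move=> osc t t0; have [C C0 HC] := cesaro_dist_bounded osc.
have [q [m0 [q0 Hq]]] := osc 1 ltr01.
(* The shift identity yields [d] terms of size at most [1 + C]; their total stays below [n * t]
   because [1 + C < r * t] and [r * d <= n]. *)
pose r := Num.bound ((1 + C) / t).
have rP : (1 + C) / t < r%:R.
  by rewrite archi_boundP // divr_ge0 ?addr_ge0 // ltW.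
exists (q + r)%N, m0.+1; split=> [|n d m0n qdn]; first by rewrite addn_gt0 q0.
have n0 : (0 < n)%N by lia.
have n0R : 0 < n%:R :> R by rewrite ltr0n.
rewrite -(ler_pM2l n0R) -{1}(ger0_norm (ltW n0R)) -(seminormZ pP).
rewrite cesaro_shift // (@le_trans _ _ (d%:R * (1 + C))) //.
  rewrite -[X in X%:R](addKn n d) -subSS; apply: seminorm_sum_le => j nj.
  (* Oscillation takes [u j] to the last term of the window at cost 1, and [C] bounds the distance
     from there to the mean. *)
  have := seminorm_dist_triangle (u (n + d)%N) (u j) (cesaro u (n + d)).
  have : p (u j - u (n + d)%N) <= 1.
    rewrite seminorm_distC (_ : n + d = j + (n + d - j))%N; last by lia.
    by apply: Hq; nia.
  by have := HC (n + d)%N (ltn_addr _ n0); lra.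
rewrite ltr_pdivrMr // in rP.
apply: (@le_trans _ _ (d%:R * (r%:R * t))); first by rewrite ler_wpM2l // ltW.
by rewrite mulrA -natrM ler_wpM2r ?(ltW t0) // ler_nat; nia.
Qed.

(** The shift identity expresses [d *: (u n - s)] through [n] times a difference of means and an
    oscillation sum. With [d = n %/ q] the ratio [n / d] is at most [2 * q], so dividing by [d]
    keeps both small. *)
Lemma slowly_oscillating_cesaro_cvg u a : slowly_oscillating p u ->
  seminorm_cvg p (cesaro u) a -> seminorm_cvg p u a.
Proof.
move=> osc cva t t0; have t3 : 0 < t / 3 by rewrite divr_gt0.
have [q [m0 [q0 Hq]]] := osc _ t3.
(* The factor [4 * q] offsets [n / d <= 2 * q] and the two errors made when comparing the means at
   [n] and [n + d] through [a]. *)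
have e0 : 0 < t / 3 / (4 * q)%:R by rewrite divr_gt0 // ltr0n muln_gt0.
have [n1 Hn1] := cva _ e0.
exists (m0 + n1 + q)%N => n nn.
pose d := (n %/ q)%N.
have d0 : (0 < d)%N by rewrite divn_gt0 //; lia.
have qdn : (q * d <= n)%N by rewrite mulnC leq_trunc_div.
have nqd : (n <= 2 * q * d)%N.
  by have := divn_eq n q; have := ltn_pmod n q0; rewrite -/d; nia.
have d0R : 0 < d%:R :> R by rewrite ltr0n.
have n0 : (0 < n)%N by lia.
have [s1 s2] : p (cesaro u n - a) <= t / 3 / (4 * q)%:R /\
    p (cesaro u (n + d) - a) <= t / 3 / (4 * q)%:R by split; apply: Hn1; lia.
have q4 : t / 3 / (4 * q)%:R <= t / 3 / 4.
  rewrite ler_wpM2l ?(ltW t3) // lef_pV2 ?posrE ?ltr0n ?muln_gt0 //.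
  by rewrite ler_nat; lia.
set s := cesaro u (n + d) in s1 s2 *.
have sE : d%:R *: (u n - s) = n%:R *: (s - cesaro u n) -
    \sum_(n.+1 <= j < (n + d).+1) (u j - u n).
  rewrite cesaro_shift // -/s !sumrB !sumr_const_nat subSS addKn !scaler_nat.
  by rewrite opprB [RHS]addrC addrA subrK mulrnBl.
have sum_le : p (\sum_(n.+1 <= j < (n + d).+1) (u j - u n)) <= d%:R * (t / 3).
  rewrite -[X in X%:R](addKn n d) -subSS; apply: seminorm_sum_le => j nj.
  by rewrite (_ : j = n + (j - n))%N; [apply: Hq; nia|lia].
have uns : p (u n - s) <= t / 3 + t / 3.
  rewrite -(ler_pM2l d0R) -{1}(ger0_norm (ltW d0R)) -(seminormZ pP) sE.
  rewrite (le_trans (seminormD pP _ _)) // seminormN mulrDr lerD //.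
  rewrite (seminormZ pP) ger0_norm //.
  have := seminorm_dist_triangle a s (cesaro u n).
  rewrite (seminorm_distC a) => sn.
  apply: (@le_trans _ _ ((2 * q * d)%:R * (2 * (t / 3 / (4 * q)%:R)))).
    by apply: ler_pM; rewrite ?seminorm_ge0 ?ler_nat //; lra.
  rewrite !natrM le_eqVlt; apply/orP; left; apply/eqP; field.
  by rewrite pnatr_eq0 -lt0n.
have := seminorm_dist_triangle s (u n) a; lra.
Qed.

(** Oscillation carries the closeness to [a] from one good index of the window back to its left end
    [n]. *)
Lemma slowly_oscillating_frequently_cvg u a : slowly_oscillating p u ->
  (forall (t : R) (q : nat), 0 < t -> (0 < q)%N -> exists n0 : nat,
    forall n, (n0 <= n)%N ->
    exists2 d : nat, (q * d <= n)%N & p (u (n + d)%N - a) <= t) ->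
  seminorm_cvg p u a.
Proof.
move=> osc freq t t0; have t2 : 0 < t / 2 by rewrite divr_gt0.
have [q [m0 [q0 Hq]]] := osc _ t2.
have [n0 Hn0] := freq _ _ t2 q0.
exists (m0 + n0)%N => n nn; have [d qd pd] := Hn0 n ltac:(lia).
have := Hq n d ltac:(lia) qd.
have := seminorm_dist_triangle (u (n + d)%N) (u n) a.
rewrite (seminorm_distC (u n) (u (n + d)%N)); lra.
Qed.

Lemma slowly_oscillating_holder_mean u m :
  slowly_oscillating p u -> slowly_oscillating p (holder_mean u m).
Proof. by move=> osc; elim: m => //= m; exact: slowly_oscillating_cesaro. Qed.

Lemma slowly_oscillating_holder_cvg u m a : slowly_oscillating p u ->
  seminorm_cvg p (holder_mean u m) a -> seminorm_cvg p u a.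
Proof.
move=> osc; elim: m => //= m IH cva; apply: IH.
exact: slowly_oscillating_cesaro_cvg (slowly_oscillating_holder_mean _ osc) cva.
Qed.

End Tauberian.

(** * Sets of density zero *)

(** If [n + d] were bad for all [d] up to [L = n %/ q], at least [L] of the indices up to
    [n + L < (2 * q + 1) * L] would be bad, a proportion above [1 / (2 * q + 1)]. *)
Lemma density0_window (R : realType) (B : pred nat) (q : nat) :
  n%:R^-1 * #|[pred k : 'I_n.+1 | (1 <= k)%N && B k]|%:R
    @[n --> \oo] --> (0 : R) ->
  (0 < q)%N -> exists n0 : nat, forall n, (n0 <= n)%N ->
    exists2 d : nat, (q * d <= n)%N & ~~ B (n + d)%N.
Proof.
move=> /cvgrPdist_lt/(_ (2 * q).+1%:R^-1) + q0.
rewrite invr_gt0 ltr0n => /(_ isT)[n1 _ Hn1].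
exists (n1 + q)%N => n nn; set L := (n %/ q)%N.
have L0 : (0 < L)%N by rewrite divn_gt0 //; lia.
have qLn : (q * L <= n)%N by rewrite mulnC leq_trunc_div.
have nqL : (n < 2 * q * L)%N.
  by have := divn_eq n q; have := ltn_pmod n q0; rewrite -/L; nia.
apply: contrapT => nd.
have nB d : (q * d <= n)%N -> B (n + d)%N.
  by move=> qd; apply: contrapT => /negP nBd; apply: nd; exists d.
have := Hn1 (n + L)%N ltac:(rewrite /=; lia).
apply/negP; rewrite -leNgt sub0r normrN ger0_norm ?mulr_ge0 ?invr_ge0 //.
set P := [pred k | _].
have lt_L (i : 'I_L) : (n + i.+1 < (n + L).+1)%N by rewrite ltnS leq_add2l.
(* The shift [i.+1] lists [n + 1] to [n + L], which are positive as the counted set demands. *)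
pose f (i : 'I_L) := Ordinal (lt_L i).
have f_inj : injective f.
  by move=> i j /(congr1 val)/= /eqP; rewrite eqn_add2l eqSS => /eqP/val_inj.
have LP : (L <= #|P|)%N.
  rewrite -{1}[L]card_ord -(card_codom f_inj); apply: subset_leq_card.
  apply/fintype.subsetP => _ /codomP[i ->]; rewrite !inE /= addnS /=.
  rewrite -addnS; apply: nB.
  by rewrite (leq_trans _ qLn) // leq_mul2l ltn_ord orbT.
have K0 : 0 < (n + L)%:R :> R by rewrite ltr0n; lia.
rewrite ler_pdivlMl // ler_pdivrMr ?ltr0n // -natrM ler_nat; nia.
Qed.

(* Because (d) and (i) use min and max, the level sets of [mu] and [nu] at a
   fixed [eps] are the balls of a single seminorm. *)
Definition ifn_gauge (R : realType) (N : lmodType R) (mu nu : N -> R -> R)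
    (eps : R) (x : N) : R :=
  inf [set t | mu x t > 1 - eps /\ nu x t < eps].

(** * The gauge seminorm of an intuitionistic fuzzy norm *)

Section Gauge.
Context (R : realType) (N : lmodType R) (mu nu : N -> R -> R) (eps : R).
Hypothesis ifnP : is_ifnorm mu nu.
Hypothesis eps01 : 0 < eps < 1.

Let ball x t := mu x t > 1 - eps /\ nu x t < eps.
Let p := ifn_gauge mu nu eps.

Let eps_gt0 : 0 < eps. Proof. by case/andP: eps01. Qed.
Let eps_lt1 : eps < 1. Proof. by case/andP: eps01. Qed.

Let ball_gt0 x t : ball x t -> 0 < t.
Proof.
move=> [mut _]; rewrite ltNge; apply/negP => t0.
by move: mut; rewrite (ifn_mu_le0 ifnP) // subr_lt0 ltNge (ltW eps_lt1).
Qed.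

Let ballD x y s t : ball x s -> ball y t -> ball (x + y) (s + t).
Proof.
move=> [x1 x2] [y1 y2]; split.
  by rewrite (lt_le_trans _ (ifn_muD ifnP _ _ _ _)) // lt_min x1.
by rewrite (le_lt_trans (ifn_nuD ifnP _ _ _ _)) // gt_max x2.
Qed.

Let ball0 t : 0 < t -> ball 0 t.
Proof.
move=> t0; rewrite /ball (ifn_mu_eq1 ifnP 0).2 // (ifn_nu_eq0 ifnP 0).2 //.
by rewrite ltrBlDr ltrDl eps_gt0.
Qed.

(** Monotonicity in the radius comes from adding the zero vector with radius [t - s]. *)
Let ball_lt x s t : s < t -> ball x s -> ball x t.
Proof.
by rewrite -subr_gt0 => /ball0/[swap]/ballD/[apply]; rewrite addr0 subrKC.
Qed.

Let ballZ c x t : c != 0 -> ball x t -> ball (c *: x) (`|c| * t).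
Proof.
move=> c0 xt; have c0' : 0 < `|c| by rewrite normr_gt0.
have t0 := ball_gt0 xt.
rewrite /ball (ifn_muZ ifnP) ?(ifn_nuZ ifnP) ?mulr_gt0 //.
by rewrite [`|c| * t]mulrC mulfK ?gt_eqF.
Qed.

(** The limits at infinity supply a radius, so that [inf] is a genuine infimum and not its default
    value 0. *)
Let ball_neq0 x : [set t | ball x t] !=set0.
Proof.
have /cvgrPdist_lt/(_ eps) := ifn_mu_cvgy ifnP x.
have /cvgrPdist_lt/(_ eps) := ifn_nu_cvgy ifnP x.
move=> /(_ eps_gt0) nux /(_ eps_gt0) mux.
have [t [h1 h2]] := filter_ex (filterI nux mux).
exists t; move: h1 h2; rewrite sub0r normrN !ltr_norml /ball /=.
by move=> /andP[_ ?] /andP[_ ?]; split => //; lra.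
Qed.

Let ball_lbound x : has_lbound [set t | ball x t].
Proof. by exists 0 => t /ball_gt0/ltW. Qed.

Lemma ifn_gauge_le x t : mu x t > 1 - eps /\ nu x t < eps -> p x <= t.
Proof. by move=> xt; apply: ge_inf => //; exact: ball_lbound. Qed.

(** The infimum need not be attained, hence the strict inequality, in contrast with
    [ifn_gauge_le]. *)
Lemma ifn_gauge_lt x t : p x < t -> mu x t > 1 - eps /\ nu x t < eps.
Proof.
by move=> /(inf_lt (ball_neq0 x))[s xs /ball_lt]; apply.
Qed.

Let gauge_ge0 x : 0 <= p x.
Proof. by apply: lb_le_inf => [|t /ball_gt0/ltW//]; exact: ball_neq0. Qed.

Let gaugeZ_le c x : p (c *: x) <= `|c| * p x.
Proof.
have [->|c0] := eqVneq c 0.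
  rewrite scale0r normr0 mul0r; apply/ler_addgt0Pr => e e0; rewrite add0r.
  exact/ifn_gauge_le/ball0.
have c0' : 0 < `|c| by rewrite normr_gt0.
apply/ler_addgt0Pr => e e0; apply: ifn_gauge_le.
rewrite -[e](mulVKf (lt0r_neq0 c0')) -mulrDr; apply: ballZ => //.
by apply: ifn_gauge_lt; rewrite ltrDl mulr_gt0 // invr_gt0.
Qed.

Lemma ifn_gauge_seminorm : is_seminorm p.
Proof.
split=> [x y|c x].
  apply/ler_addgt0Pr => e e0; have e2 : 0 < e / 2 by rewrite divr_gt0.
  rewrite [e]splitr addrACA; apply: ifn_gauge_le.
  by apply: ballD; apply: ifn_gauge_lt; rewrite ltrDl.
have [->|c0] := eqVneq c 0.
  apply/eqP; rewrite eq_le gaugeZ_le normr0 mul0r; exact: gauge_ge0.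
have c0' : 0 < `|c| by rewrite normr_gt0.
(* The reverse inequality is [gaugeZ_le] for the scalar [c^-1] and the vector [c *: x]. *)
apply/eqP; rewrite eq_le gaugeZ_le /= -ler_pdivlMl //.
by rewrite -normfV (le_trans _ (gaugeZ_le _ _)) // scalerA mulVf // scale1r.
Qed.

Lemma slowly_oscillating_gauge (u : nat -> N) :
  ifn_slowly_oscillating mu nu u -> slowly_oscillating p u.
Proof.
move=> osc t t0; have [l [m0 [l1 Hl]]] := osc t eps t0 eps01.
have l10 : 0 < l - 1 by rewrite subr_gt0.
(* With [q > 1 / (l - 1)], the condition [q * d <= n] forces [n + d <= l * n]. *)
pose q := Num.bound (l - 1)^-1.
have lq : (l - 1)^-1 < q%:R by rewrite archi_boundP // invr_ge0 ltW.
have q0 : (0 < q)%N by rewrite -(ltr0n R) (lt_trans _ lq) // invr_gt0.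
exists q, m0; split=> // n [|d] m0n qdn.
  (* The fuzzy hypothesis compares only distinct indices, so [d = 0] is treated apart. *)
  rewrite addn0 subrr; apply: ifn_gauge_le; exact: ball0.
apply/ifn_gauge_le/Hl => //; first by rewrite -addSnnS leq_addr.
rewrite floor_ge_int -pmulrn natrD -lerBrDl -{2}[n%:R]mul1r -mulrBl.
rewrite -ler_pdivrMl // (le_trans (y := q%:R * d.+1%:R)) //.
  by rewrite ler_wpM2r // ltW.
by rewrite -natrM ler_nat.
Qed.

Lemma stat_converges_gauge (v : nat -> N) (a : N) (t : R) (q : nat) :
  ifn_stat_converges mu nu v a -> 0 < t -> (0 < q)%N -> exists n0 : nat,
    forall n, (n0 <= n)%N ->
    exists2 d : nat, (q * d <= n)%N & p (v (n + d)%N - a) <= t.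
Proof.
move=> sv t0 q0.
have [n0 Hn0] := density0_window (B := fun k =>
  (mu (v k - a) t <= 1 - eps) || (nu (v k - a) t >= eps)) (sv _ _ eps_gt0 t0) q0.
exists n0 => n /Hn0[d qd]; rewrite negb_or -!ltNge => /andP[h1 h2].
by exists d => //; apply: ifn_gauge_le.
Qed.

End Gauge.

(** * Transfer from the gauge seminorms back to the fuzzy norm *)

Theorem theorem2p10 (R : realType) (N : lmodType R) (mu nu : N -> R -> R)
    (u : nat -> N) (a : N) (m : nat) :
  is_ifnorm mu nu ->
  (1 <= m)%N ->
  ifn_stat_holder_summable mu nu m u a ->
  ifn_slowly_oscillating mu nu u ->
  ifn_converges mu nu u a.
Proof.
move=> ifnP _ summ osc eps t eps0 t0.
(* The gauge is a seminorm for levels below 1, whereas [eps] is any positive number. *)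
pose e := Num.min eps (1 / 2).
have e01 : 0 < e < 1 by rewrite lt_min gt_min eps0 /=; apply/andP; split; [lra|apply/orP; right; lra].
have pP := ifn_gauge_seminorm ifnP e01.
have posc := slowly_oscillating_gauge ifnP e01 osc.
have cvH : seminorm_cvg (ifn_gauge mu nu e) (holder_mean u m) a.
  apply: (slowly_oscillating_frequently_cvg pP).
    exact: slowly_oscillating_holder_mean.
  by move=> s q s0 q0; exact: stat_converges_gauge.
have cvu := slowly_oscillating_holder_cvg pP posc cvH.
(* Halving [t] yields the strict inequality that [ifn_gauge_lt] requires. *)
have [k0 Hk0] := cvu (t / 2) ltac:(lra).
exists k0 => k _ /Hk0 uk.
have /(ifn_gauge_lt ifnP e01)[h1 h2] : ifn_gauge mu nu e (u k - a) < t by lra.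
have : e <= eps by rewrite ge_min lexx.
lra.
Qed.
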